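(* Let $n\ge 1$ and $w=w_1w_2\cdots w_n\in S_n$. Let $re(w)$ be the number of regions of the inversion hyperplane arrangement $\mathcal{A}_w$, and let $wk(w)$ be the number of permutations $u\in S_n$ with $u\le w$ in the left weak Bruhat order. Then $$re(w)\ge wk(w),$$ with equality if and only if $w$ avoids both patterns $231$ and $312$.
   Context: A permutation $w\in S_n$ is written in one-line notation $w=w_1\cdots w_n$ with $w_i=w(i)$; products are composition of functions. An inversion of $w$ is a pair $(i,j)$ with $1\le i<j\le n$ and $w_i>w_j$; $I(w)$ is the set of inversions and $\mathrm{inv}(w)=|I(w)|$. The inversion hyperplane arrangement $\mathcal{A}_w$ is the collection of hyperplanes $x_i-x_j=0$ in $\mathbb{R}^n$ for all inversions $(i,j)$ of $w$; its regions are the connected components of $\mathbb{R}^n\setminus\bigcup_{H\in\mathcal{A}_w}H$. Let $s_i=(i,i+1)$ for $1\le i\le n-1$. In the left weak Bruhat order, $u\le v$ if $v=s_{i_1}s_{i_2}\cdots s_{i_k}u$ for some adjacent transpositions with $\mathrm{inv}(s_{i_r}s_{i_{r+1}}\cdots s_{i_k}u)=\mathrm{inv}(u)+(k-r+1)$ for each $r$ (each left multiplication increases the number of inversions by one). For $\pi\in S_k$, $w$ contains the pattern $\pi$ if there are indices $i_1<\cdots<i_k$ such that $w_{i_1}\cdots w_{i_k}$ is order-isomorphic to $\pi_1\cdots\pi_k$; otherwise $w$ avoids $\pi$. *)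

(* Defs.v *)
From HB Require Import structures.
From mathcomp Require Import all_boot all_order all_algebra all_fingroup.
From mathcomp Require Import finmap.
From mathcomp Require Import all_classical all_reals all_analysis.

Set Implicit Arguments.
Unset Strict Implicit.
Unset Printing Implicit Defensive.

Import Order.TTheory GRing.Theory Num.Theory.
Import numFieldNormedType.Exports.

Local Open Scope classical_set_scope.
Local Open Scope ring_scope.

(* Positions and values are 0-based: the one-line notation of [w : 'S_n] is
   w 0, ..., w (n-1). *)

Definition inversions (n : nat) (w : 'S_n) : {set 'I_n * 'I_n} :=
  [set p : 'I_n * 'I_n | (p.1 < p.2)%N && (w p.2 < w p.1)%N]%SET.

Definition num_inv (n : nat) (w : 'S_n) : nat := #|inversions w|.

Definition diag_hyperplane (R : realType) (n : nat) (i j : 'I_n) :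
    set 'rV[R]_n :=
  [set x | x ord0 i - x ord0 j = 0].

Definition inversion_arrangement (R : realType) (n : nat) (w : 'S_n) :
    set (set 'rV[R]_n) :=
  [set diag_hyperplane p.1 p.2 | p in [set` inversions w]].
Arguments inversion_arrangement R {n} w.

(* The topology on 'rV[R]_n is the product topology. *)
Definition regions (R : realType) (n : nat) (A : set (set 'rV[R]_n)) :
    set (set 'rV[R]_n) :=
  let U := ~` \bigcup_(H in A) H in
  [set connected_component U x | x in U].

(* [fset_set] sends an infinite set to [fset0], so [0 < re R w] also says that
   there are finitely many regions. *)
Definition re (R : realType) (n : nat) (w : 'S_n) : nat :=
  #|` fset_set (regions (inversion_arrangement R w))|%fset.

Definition adjacent_transposition (n : nat) (s : 'S_n) : bool :=
  [exists i : 'I_n, exists j : 'I_n, (j == i.+1 :> nat) && (s == tperm i j)].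

(* The product s_1 s_2 ... s_k u for [word = [:: s_1; ...; s_k]], as a
   composition of functions (u is applied first).  MathComp composes in the
   opposite order: [(p * s)%g x = s (p x)]. *)
Definition word_mul (n : nat) (word : seq 'S_n) (u : 'S_n) : 'S_n :=
  foldr (fun s p => (p * s)%g) u word.

Definition left_weak_le (n : nat) (u v : 'S_n) : Prop :=
  exists word : seq 'S_n,
    [/\ all (@adjacent_transposition n) word,
        v = word_mul word u &
        forall r : nat, (r < size word)%N ->
          num_inv (word_mul (drop r word) u) = (num_inv u + (size word - r))%N].

Definition wk (n : nat) (w : 'S_n) : nat :=
  #|[set u : 'S_n | `[< left_weak_le u w >]]%SET|.

Definition contains_pattern (n k : nat) (w : 'S_n) (pi : 'S_k) : Prop :=
  exists f : 'I_k -> 'I_n,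
    (forall a b : 'I_k, (a < b)%N -> (f a < f b)%N) /\
    (forall a b : 'I_k, (w (f a) < w (f b))%N = (pi a < pi b)%N).

Definition avoids (n k : nat) (w : 'S_n) (pi : 'S_k) : Prop :=
  ~ contains_pattern w pi.

Definition perm_of_oneline (k : nat) (t : k.-tuple 'I_k) (t_uniq : uniq t) :
    'S_k :=
  perm (elimT (tuple_uniqP t) t_uniq).

Definition perm231 : 'S_3 :=
  @perm_of_oneline 3 [tuple @Ordinal 3 1 isT; @Ordinal 3 2 isT; @Ordinal 3 0 isT]
    isT.

Definition perm312 : 'S_3 :=
  @perm_of_oneline 3 [tuple @Ordinal 3 2 isT; @Ordinal 3 0 isT; @Ordinal 3 1 isT]
    isT.

(* Main.v *)
Require Import Defs.
From mathcomp Require Import all_boot all_order all_algebra all_fingroup.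
From mathcomp Require Import finmap zify lra.
From mathcomp Require Import all_classical all_reals all_analysis.

(* Write S(x) = {(i,j) in I(w) | x_i > x_j} for a point x off the hyperplanes.
   The regions of A_w are the fibres of S: a fibre is convex, and no x_i - x_j
   with (i,j) in I(w) changes sign on a connected set avoiding the hyperplanes.
   On the other side, u <= w in the left weak order iff I(u) is contained in
   I(w).  For such u, the point (u_1,...,u_n) has S = I(u), so the inversion sets
   counted by wk(w) are among the sets S(x) counted by re(w), and equality means
   that every S(x) is an inversion set.  S(x) is always transitive, and an
   inversion (i,k) of w with i < j < k can be cut at j as soon as w_j lies between
   w_k and w_i; hence if w avoids 231 and 312 then S(x) is biclosed, i.e. an
   inversion set.  Conversely, if w has a 231 (312) at positions i < j < k, rotating
   its values to the pattern 312 (231) gives a point x with (i,k) in S(x) but neither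
   (i,j) nor (j,k) in S(x). *)

Set Implicit Arguments.
Unset Strict Implicit.
Unset Printing Implicit Defensive.

Import Order.TTheory GRing.Theory Num.Theory.
Import numFieldNormedType.Exports.

Local Open Scope nat_scope.

(** * Inversion sets and the left weak order *)

Lemma mem_inversions n (u : 'S_n) (i j : 'I_n) :
  ((i, j) \in inversions u) = (i < j) && (u j < u i).
Proof. by rewrite inE. Qed.

Lemma perm_lt_total n (u : 'S_n) (i j : 'I_n) : i != j -> ~~ (u j < u i) = (u i < u j).
Proof.
by move=> ne; rewrite -leqNgt leq_eqVlt; case: eqP => // /val_inj/perm_inj/eqP; rewrite (negPf ne).
Qed.

Lemma ord_lt_neq n (i j : 'I_n) : i < j -> (i != j) * (j != i).
Proof. by move=> ij; rewrite [j == i]eq_sym -val_eqE neq_ltn ij. Qed.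

Lemma card_ord_lt n m : m <= n -> #|[set k : 'I_n | k < m]%SET| = m.
Proof.
move=> le_mn; rewrite -sum1_card (eq_bigl (fun k : 'I_n => k < m)); last by move=> k; rewrite inE.
by rewrite -(big_ord_widen n (fun=> 1)) // sum1_card card_ord.
Qed.

(** Since [u] is a bijection, the values below [u i] can be counted by their positions; hence the
    order of the values alone recovers [u]. *)
Lemma perm_rank n (u : 'S_n) (i : 'I_n) : u i = #|[set j | u j < u i]%SET| :> nat.
Proof.
rewrite -[LHS](card_ord_lt (ltnW (ltn_ord (u i)))) -[LHS](card_preimset _ (@perm_inj _ u)).
by apply: eq_card => j; rewrite !inE.
Qed.

(** Both value orders on positions are total, so the implication is an equivalence, and equal ranks
    give equal values. *)
Lemma perm_lt_homo_eq n (u w : 'S_n) :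
  (forall i j, u i < u j -> w i < w j) -> u = w.
Proof.
move=> uw; apply/permP => i; apply: val_inj; rewrite /= perm_rank [RHS]perm_rank.
apply: eq_card => j; rewrite !inE; apply/idP/idP => [/uw //|].
have [->|ne] := eqVneq j i; first by rewrite ltnn.
have ne' : i != j by rewrite eq_sym.
by apply: contraTT; rewrite !(perm_lt_total _ ne'); apply: uw.
Qed.

Lemma inversions_inj n : injective (@inversions n).
Proof.
move=> u w /setP uw; apply: perm_lt_homo_eq => i j lt_u.
have [lt_ij|lt_ji|/val_inj eq_ij] := ltngtP i j.
- have ne : i != j by rewrite neq_ltn lt_ij.
  move: (uw (i, j)); rewrite !mem_inversions lt_ij /= => eq_lt.
  by rewrite -(perm_lt_total w ne) -eq_lt perm_lt_total.
- by move: (uw (j, i)); rewrite !mem_inversions lt_ji lt_u /= => <-.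
- by rewrite eq_ij ltnn in lt_u.
Qed.

(** No value lies strictly between [u i] and [u j], so exchanging them alters only the comparison at
    positions [i] and [j]. *)
Lemma inversions_mul_tperm n (u : 'S_n) (i j : 'I_n) : i < j -> u j = (u i).+1 :> nat ->
  inversions (u * tperm (u i) (u j))%g = ((i, j) |: inversions u)%SET.
Proof.
move=> lt_ij uij; apply/setP => -[x y]; rewrite in_setU1 !mem_inversions !permM xpair_eqE.
have neqs (a b : 'I_n) : u a <> u b -> (u a != u b :> nat) && (a != b :> nat).
  move=> ne; apply/andP; split; apply/eqP => /val_inj; first exact: ne.
  by move=> eq_ab; apply: ne; rewrite eq_ab.
case: (tpermP (u i) (u j) (u y)) => [/perm_inj->|/perm_inj->|/neqs+/neqs+];
  case: (tpermP (u i) (u j) (u x)) => [/perm_inj->|/perm_inj->|/neqs+/neqs+];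
  rewrite -!val_eqE /= => *; lia.
Qed.

Lemma num_inv_mul_tperm n (u : 'S_n) (i j : 'I_n) : i < j -> u j = (u i).+1 :> nat ->
  num_inv (u * tperm (u i) (u j))%g = (num_inv u).+1.
Proof.
move=> lt_ij uij; rewrite /num_inv inversions_mul_tperm // cardsU1 mem_inversions.
by rewrite lt_ij uij -leqNgt leqW.
Qed.

Lemma adjacent_step_sub n (u s : 'S_n) : adjacent_transposition s ->
  num_inv u < num_inv (u * s)%g -> inversions u \subset inversions (u * s)%g.
Proof.
case/existsP => a /existsP[b] /andP[/eqP ab /eqP->].
pose i := (u^-1 a)%g; pose j := (u^-1 b)%g.
have ui : u i = a by rewrite permKV.
have uj : u j = b by rewrite permKV.
have [lt_ij _|lt_ji|/val_inj eq_ij] := ltngtP i j.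
- by rewrite -ui -uj inversions_mul_tperm ?ui ?uj // finset.subsetUr.
(* Here the exchange destroys an inversion: [u] arises from [v] by a step that adds one, against the
   growth of [num_inv]. *)
- set v := (u * tperm a b)%g.
  have vi : v i = b by rewrite permM ui tpermL.
  have vj : v j = a by rewrite permM uj tpermR.
  have -> : u = (v * tperm (v j) (v i))%g by rewrite vi vj -mulgA tperm2 mulg1.
  by rewrite num_inv_mul_tperm ?vi ?vj // ltnNge leqnSn.
- by move: ab; rewrite -ui -uj eq_ij => /n_Sn.
Qed.

Lemma left_weak_le_sub n (u w : 'S_n) : left_weak_le u w -> inversions u \subset inversions w.
Proof.
case=> word [+ -> {w}]; elim: word => [|s word IH] //= /andP[adj_s adj_word] lens.
have len_tail : num_inv (word_mul word u) = num_inv u + size word.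
  case: word lens {IH adj_word} => [|t word] lens; first by rewrite addn0.
  exact: (lens 1 isT).
apply: (fintype.subset_trans (IH adj_word _)) => [r lt_r|]; first exact: (lens r.+1).
by apply: adjacent_step_sub => //; rewrite -/(word_mul _ _) len_tail (lens 0) //= subn0 addnS.
Qed.

(* Otherwise [w * u^-1] is increasing on consecutive values, hence the identity. *)
Lemma exists_adjacent_step n (u w : 'S_n) : inversions u \subset inversions w -> u != w ->
  exists i j : 'I_n, [/\ i < j, u j = (u i).+1 :> nat & (i, j) \in inversions w].
Proof.
move=> /fintype.subsetP sub /eqP ne; apply: contrapT => none; apply: ne; apply: perm_lt_homo_eq.
have consecutive (i j : 'I_n) : u j = (u i).+1 :> nat -> w i < w j.
  move=> uij; have [lt_ij|lt_ji|/val_inj eq_ij] := ltngtP i j.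
  - have : (i, j) \notin inversions w by apply/negP => ?; apply: none; exists i, j.
    by rewrite mem_inversions lt_ij /= perm_lt_total // neq_ltn lt_ij.
  - have : (j, i) \in inversions u by rewrite mem_inversions lt_ji uij /=.
    by move/sub; rewrite mem_inversions lt_ji.
  - by rewrite eq_ij in uij; move: uij => /n_Sn.
suff lt_step d (i j : 'I_n) : u j = u i + d.+1 :> nat -> w i < w j.
  by move=> i j lt_u; apply: (lt_step (u j - (u i).+1)); lia.
elim: d i j => [|d IH] i j uij; first by apply: consecutive; rewrite uij addn1.
have lt_k : u i + d.+1 < n by have := ltn_ord (u j); lia.
pose k := (u^-1 (Ordinal lt_k))%g; have uk : u k = u i + d.+1 :> nat by rewrite permKV.
by apply: (ltn_trans (IH i k uk)); apply: consecutive; rewrite uij uk addnS.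
Qed.

(** Induction on the number of inversions that [u] lacks: an adjacent step adds one of them and
    keeps the inclusion in [inversions w]. *)
Lemma sub_left_weak_le n (u w : 'S_n) : inversions u \subset inversions w -> left_weak_le u w.
Proof.
have [m] := ubnP (num_inv w - num_inv u); elim: m u => // m IH u le_m sub.
have [->|ne] := eqVneq u w; first by exists [::].
have [i [j [lt_ij uij ij_w]]] := exists_adjacent_step sub ne.
set s := tperm (u i) (u j); set v := (u * s)%g.
have num_v : num_inv v = (num_inv u).+1 by apply: num_inv_mul_tperm.
have sub_v : inversions v \subset inversions w.
  by rewrite inversions_mul_tperm // finset.subUset finset.sub1set ij_w.
have le_v : num_inv v <= num_inv w by apply: subset_leq_card.
have [|word [adj_word -> len_word]] := IH v _ sub_v; first by lia.
(* The last letter of a word acts first, so the new step goes to its end. *)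
have mul_rcons l : word_mul (rcons l s) u = word_mul l v by rewrite /word_mul foldr_rcons.
exists (rcons word s); split; last 1 first.
- move=> r; rewrite size_rcons ltnS => le_r; rewrite drop_rcons // mul_rcons.
  move: le_r; rewrite leq_eqVlt => /orP[/eqP->|lt_r]; first by rewrite drop_size /= num_v; lia.
  by rewrite len_word // num_v; lia.
- rewrite all_rcons adj_word andbT; apply/existsP; exists (u i); apply/existsP; exists (u j).
  by rewrite uij !eqxx.
- by rewrite mul_rcons.
Qed.

Lemma left_weak_leE n (u w : 'S_n) : left_weak_le u w <-> inversions u \subset inversions w.
Proof. by split; [apply: left_weak_le_sub | apply: sub_left_weak_le]. Qed.

(** * Permutations from biclosed sets *)

Lemma biclosed_inversions n (S : {set 'I_n * 'I_n}) :
  (forall i j : 'I_n, (i, j) \in S -> i < j) ->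
  (forall i j k : 'I_n, (i, j) \in S -> (j, k) \in S -> (i, k) \in S) ->
  (forall i j k : 'I_n, i < j -> j < k -> (i, k) \in S -> (i, j) \in S \/ (j, k) \in S) ->
  exists u : 'S_n, inversions u = S.
Proof.
move=> S_lt S_trans S_cotrans.
(* The one-line notation of [u] lists the ranks for this total order on positions. *)
pose prec (i j : 'I_n) := if i < j then (i, j) \notin S else (j, i) \in S.
have precxx i : prec i i = false.
  by rewrite /prec ltnn; apply/negP => /S_lt; rewrite ltnn.
have prec_asym i j : i != j -> prec j i = ~~ prec i j.
  by rewrite /prec -val_eqE /=; case: ltngtP => //= _ _; rewrite negbK.
have prec_trans i j k : prec i j -> prec j k -> prec i k.
  have [->|ne_ij] := eqVneq i j; first by rewrite precxx.
  have [->|ne_jk] := eqVneq j k; first by rewrite precxx.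
  have [eq_ik|ne_ik] := eqVneq i k; first by rewrite eq_ik (prec_asym k j) -?eq_ik // => ->.
  rewrite /prec; move: ne_ij ne_jk ne_ik; rewrite -!val_eqE /=.
  (* Six orders of three distinct positions remain; three follow from [S_cotrans], three from
     [S_trans]. *)
  case: ltngtP => // ij; case: ltngtP => // jk; case: ltngtP => // ik _ _ _; try lia.
  - by have := S_cotrans i j k ij jk; lia.
  - by have := S_trans i k j; lia.
  - by have := S_cotrans k i j ik ij; lia.
  - by have := S_trans j i k; lia.
  - by have := S_cotrans j k i jk ik; lia.
  - by have := S_trans k j i; lia.
pose f (i : 'I_n) := #|[set j | prec j i]%SET|.
have f_lt i j : prec i j -> f i < f j.
  move=> ij; apply: proper_card; apply/fintype.properP; split.
    by apply/fintype.subsetP => k; rewrite !inE => /prec_trans; apply.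
  by exists i; rewrite inE // precxx.
have f_ltn i : f i < n.
  rewrite -[X in _ < X]card_ord -cardsT; apply: proper_card; apply/fintype.properP.
  by split; [apply/fintype.subsetP => k; rewrite inE | exists i; rewrite inE // precxx].
have f_inj : injective (fun i => Ordinal (f_ltn i)).
  move=> i j [eq_f]; apply/eqP/negPn/negP => ne.
  have : prec i j || prec j i by rewrite [prec j i]prec_asym // orbN.
  by case/orP => /f_lt; rewrite eq_f ltnn.
exists (perm f_inj); apply/setP => -[i j]; rewrite mem_inversions !permE /=.
apply/andP/idP => [[lt_ij lt_f]|ijS].
  apply: contraLR lt_f => ijS; rewrite -leqNgt ltnW // f_lt //.
  by rewrite /prec lt_ij.
have lt_ij := S_lt i j ijS; split=> //; apply: f_lt.
by rewrite /prec ltnNge ltnW.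
Qed.
Local Open Scope ring_scope.

(** * Regions as fibres of sign data *)

Definition off_hyperplanes (R : realType) n (w : 'S_n) : set 'rV[R]_n :=
  (~` \bigcup_(H in inversion_arrangement R w) H)%classic.

Lemma off_hyperplanesP (R : realType) n (w : 'S_n) (x : 'rV[R]_n) :
  off_hyperplanes w x <->
  forall i j, (i, j) \in inversions w -> x ord0 i != x ord0 j.
Proof.
split=> [off i j ij|ne [_ [[i j] /= ij <-] /=]].
  apply/eqP => eq_x; apply: off; exists (diag_hyperplane i j); first by exists (i, j).
  by rewrite /diag_hyperplane /= eq_x subrr.
by move/eqP; rewrite subr_eq0; apply/negP/ne.
Qed.

(** The set S(x) of the overview: it records the side of each hyperplane on which [x] lies. *)
Definition descents (R : realType) n (w : 'S_n) (x : 'rV[R]_n) : {set 'I_n * 'I_n} :=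
  [set p in inversions w | x ord0 p.2 < x ord0 p.1]%SET.

Lemma mem_descents (R : realType) n (w : 'S_n) (x : 'rV[R]_n) i j :
  ((i, j) \in descents w x) = ((i, j) \in inversions w) && (x ord0 j < x ord0 i).
Proof. by rewrite !inE. Qed.

(** The image of [C] under the difference of the two coordinates is an interval, which a change of
    sign would force to contain 0. *)
Lemma connected_coord_lt (R : realType) n (C : set 'rV[R]_n) (i j : 'I_n) (x y : 'rV[R]_n) :
  connected C -> (forall z, C z -> z ord0 i != z ord0 j) -> C x -> C y ->
  x ord0 j < x ord0 i -> y ord0 j < y ord0 i.
Proof.
move=> conC ne Cx Cy lt_x; rewrite ltNge; apply/negP => le_y.
pose f (z : 'rV[R]_n) : R := z ord0 i - z ord0 j.
have cont_f : continuous f.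
  by move=> z; apply: (@cvgB _ _ _ (nbhs z)); apply: coord_continuous.
have /connected_intervalP itv : connected (f @` C)%classic.
  by apply: connected_continuous_connected => //; apply: continuous_subspaceT.
have [z Cz] : (f @` C)%classic 0.
  apply: (itv (f y) (f x)); [by exists y|by exists x|].
  by rewrite /f subr_le0 le_y subr_ge0 ltW.
by move/eqP; rewrite subr_eq0; apply/negP/ne.
Qed.

(** The right side exceeds the left by (1 - t)(b - a) + t(d - c), whose last term is positive once t
    > 0. *)
Lemma segment_lt (R : realType) (a b c d t : R) :
  0 <= t <= 1 -> a < b -> c < d -> a + t * (c - a) < b + t * (d - b).
Proof.
move=> /andP[t0 t1] lt_ab lt_cd; have [->|nt] := eqVneq t 0; first by rewrite !mul0r !addr0.
have t_gt0 : 0 < t by rewrite lt_neqAle eq_sym nt.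
have : 0 < t * (d - c) by rewrite mulr_gt0 // subr_gt0.
have : 0 <= (1 - t) * (b - a) by rewrite mulr_ge0 // subr_ge0 // ltW.
nra.
Qed.

Lemma segment_path_connected (R : realType) n (x y : 'rV[R]_n) :
  connected ((fun t : R => x + t *: (y - x)) @` `[0, 1])%classic.
Proof.
apply: connected_continuous_connected; first exact: segment_connected.
apply: continuous_subspaceT => t.
apply: (@cvgD _ _ _ (nbhs t)); first exact: cvg_cst.
exact: scalel_continuous.
Qed.

Lemma connected_component_off_hyperplanes (R : realType) n (w : 'S_n) (x : 'rV[R]_n) :
  off_hyperplanes w x ->
  connected_component (off_hyperplanes w) x =
  [set y | off_hyperplanes w y /\ descents w y = descents w x]%classic.
Proof.
move=> off_x; apply/seteqP; split=> y /=.
  move=> [C [Cx sub conC] Cy]; split; first exact: sub.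
  apply/setP => -[i j]; rewrite !mem_descents; case ij: (_ \in _) => //=.
  have ne z : C z -> z ord0 i != z ord0 j by move/sub/off_hyperplanesP; apply.
  by apply/idP/idP; apply: (connected_coord_lt conC ne).
move=> [off_y desc_xy].
exists ((fun t : R => x + t *: (y - x)) @` `[0, 1])%classic; last first.
  by exists 1; rewrite ?scale1r ?subrKC //= in_itv /= ler01 lexx.
split; last exact: segment_path_connected.
  by exists 0; rewrite ?scale0r ?addr0 //= in_itv /= ler01 lexx.
move=> _ [t /= t01 <-]; apply/off_hyperplanesP => i j ij.
(* Both ends lie strictly on the same side of this hyperplane, hence so does the whole segment. *)
have nx : x ord0 i != x ord0 j by move/off_hyperplanesP: off_x; apply.
have ny : y ord0 i != y ord0 j by move/off_hyperplanesP: off_y; apply.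
have := congr1 (fun S : {set _} => (i, j) \in S) desc_xy.
rewrite !mem_descents ij /= !mxE; move: t01; rewrite in_itv /= => t01.
move: nx ny; rewrite !neq_lt.
case: (ltrP (x ord0 j)) => [lt_x _ _ lt_y|_]; first by rewrite orbC segment_lt.
rewrite orbF => lt_x /orP[lt_y _|-> //]; by rewrite segment_lt.
Qed.

Definition descent_sets (R : realType) n (w : 'S_n) : {set {set 'I_n * 'I_n}} :=
  [set S | `[< exists2 x : 'rV[R]_n, off_hyperplanes w x & descents w x = S >]]%SET.
Arguments descent_sets R {n} w.

Lemma re_descent_sets (R : realType) n (w : 'S_n) : re R w = #|descent_sets R w|.
Proof.
pose cell (S : {set 'I_n * 'I_n}) : set 'rV[R]_n :=
  [set y | off_hyperplanes w y /\ descents w y = S]%classic.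
(* Writing the regions as a finite image shows that [fset_set] does not take its default value
   [fset0]. *)
have -> : re R w = #|` [fset cell S | S in descent_sets R w]%fset|.
  rewrite /re -(set_fsetK [fset cell S | S in descent_sets R w]%fset).
  congr (#|` fset_set _|%fset); apply/seteqP; split=> [_ [x off_x <-]|C] /=.
    rewrite connected_component_off_hyperplanes //; apply/imfsetP => /=.
    by exists (descents w x) => //; rewrite inE; apply/asboolP; exists x.
  move=> /imfsetP[S /=]; rewrite inE => /asboolP[x off_x <-] ->.
  by exists x => //; rewrite connected_component_off_hyperplanes.
rewrite card_in_imfset /= => [|S T]; first by rewrite -cardE.
(* Cells are nonempty, so a cell determines its label: any point of it has that descent set. *)
rewrite inE => /asboolP[x off_x <-] _ /seteqP[sub _].
by have [] := sub x (conj off_x erefl).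
Qed.

(** * Both counts as families of sets of pairs *)

Definition left_weak_inversions n (w : 'S_n) : {set {set 'I_n * 'I_n}} :=
  [set inversions u | u in [set u : 'S_n | `[< left_weak_le u w >]]]%SET.

Lemma wk_left_weak_inversions n (w : 'S_n) : wk w = #|left_weak_inversions w|.
Proof. by rewrite card_imset //; apply: inversions_inj. Qed.

Definition perm_point (R : realType) n (v : 'S_n) : 'rV[R]_n := \row_i (v i)%:R.
Arguments perm_point R {n} v.

Lemma off_hyperplanes_perm_point (R : realType) n (w v : 'S_n) :
  off_hyperplanes w (perm_point R v).
Proof.
apply/off_hyperplanesP => i j; rewrite mem_inversions !mxE eqr_nat val_eqE (inj_eq perm_inj).
by rewrite -val_eqE /=; case: ltngtP.
Qed.

Lemma descents_perm_point (R : realType) n (w v : 'S_n) :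
  descents w (perm_point R v) = (inversions w :&: inversions v)%SET.
Proof.
apply/setP => -[i j]; rewrite mem_descents finset.in_setI !mem_inversions !mxE ltr_nat.
by case: ltnP.
Qed.

(** Serves twice: with [v] below [w] for the inequality, and with a rotated [v] to refute
    equality. *)
Lemma perm_point_descent_sets (R : realType) n (w v : 'S_n) :
  (inversions w :&: inversions v)%SET \in descent_sets R w.
Proof.
rewrite inE; apply/asboolP; exists (perm_point R v); last exact: descents_perm_point.
exact: off_hyperplanes_perm_point.
Qed.

Lemma left_weak_inversions_sub (R : realType) n (w : 'S_n) :
  left_weak_inversions w \subset descent_sets R w.
Proof.
apply/fintype.subsetP => _ /imsetP[u + ->]; rewrite inE => /asboolP/left_weak_leE sub.
by rewrite -(finset.setIidPr sub) perm_point_descent_sets.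
Qed.
Local Open Scope nat_scope.

(** * Pattern avoidance and the equality case *)

Lemma perm_of_onelineE k (t : k.-tuple 'I_k) (t_uniq : uniq t) (a : 'I_k) :
  perm_of_oneline t_uniq a = tnth t a.
Proof. by rewrite permE. Qed.

Lemma contains_pattern3I n (w : 'S_n) (pi : 'S_3) (i j k : 'I_n) : i < j -> j < k ->
  (forall a b : 'I_3, (w (tnth [tuple i; j; k] a) < w (tnth [tuple i; j; k] b)) = (pi a < pi b)) ->
  contains_pattern w pi.
Proof.
move=> ij jk eq_lt; exists (tnth [tuple i; j; k]); split=> // -[[|[|[|//]]] lt_a] [[|[|[|//]]] lt_b];
  rewrite !(tnth_nth i) //= => _; exact: ltn_trans jk.
Qed.

Lemma contains231P n (w : 'S_n) :
  contains_pattern w perm231 <-> exists i j k : 'I_n, [/\ i < j, j < k, w k < w i & w i < w j].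
Proof.
split=> [[f [f_lt f_w]]|[i [j [k [ij jk ki_w ij_w]]]]].
  exists (f (@Ordinal 3 0 isT)), (f (@Ordinal 3 1 isT)), (f (@Ordinal 3 2 isT)).
  by split; rewrite ?f_w ?perm_of_onelineE //; apply: f_lt.
apply: (contains_pattern3I ij jk) => -[[|[|[|//]]] lt_a] [[|[|[|//]]] lt_b];
  rewrite !perm_of_onelineE !(tnth_nth i) !(tnth_nth ord0) /=; lia.
Qed.

Lemma contains312P n (w : 'S_n) :
  contains_pattern w perm312 <-> exists i j k : 'I_n, [/\ i < j, j < k, w j < w k & w k < w i].
Proof.
split=> [[f [f_lt f_w]]|[i [j [k [ij jk jk_w ki_w]]]]].
  exists (f (@Ordinal 3 0 isT)), (f (@Ordinal 3 1 isT)), (f (@Ordinal 3 2 isT)).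
  by split; rewrite ?f_w ?perm_of_onelineE //; apply: f_lt.
apply: (contains_pattern3I ij jk) => -[[|[|[|//]]] lt_a] [[|[|[|//]]] lt_b];
  rewrite !perm_of_onelineE !(tnth_nth i) !(tnth_nth ord0) /=; lia.
Qed.

(** The intersection of the inversion sets of [w] and [v] contains (i,k) but neither (i,j) nor
    (j,k). Were it that of some [u], then u_i < u_j < u_k would contradict u_k < u_i. *)
Lemma descent_sets_sub_coclosed (R : realType) n (w v : 'S_n) (i j k : 'I_n) :
  descent_sets R w \subset left_weak_inversions w -> i < j -> j < k ->
  w k < w i -> v k < v i -> (w i < w j) || (v i < v j) -> (w j < w k) || (v j < v k) -> False.
Proof.
move=> /fintype.subsetP sub ij jk w_ki v_ki asc_ij asc_jk.
have ik := ltn_trans ij jk.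
have /imsetP[u _ /setP eq_u] := sub _ (perm_point_descent_sets R w v).
move: (eq_u (i, k)) (eq_u (i, j)) (eq_u (j, k)).
rewrite !finset.in_setI !mem_inversions ij jk ik /=; lia.
Qed.


Lemma descent_sets_sub_avoids (R : realType) n (w : 'S_n) :
  descent_sets R w \subset left_weak_inversions w -> avoids w perm231 /\ avoids w perm312.
Proof.
move=> sub; split=> [/contains231P[i [j [k [ij jk ki_w ij_w]]]]
            |/contains312P[i [j [k [ij jk jk_w ki_w]]]]].
  (* The left factor acts first; [v] has the values w_j, w_k, w_i at i, j, k, turning 231 into
     312. *)
  pose v := (tperm i j * tperm i k * w)%g.
  have vi : v i = w j by rewrite !permM tpermL tpermD ?(ord_lt_neq ij) ?(ord_lt_neq jk).
  have vj : v j = w k by rewrite !permM tpermR tpermL.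
  have vk : v k = w i.
    by rewrite !permM (tpermD (z := k)) ?tpermR ?(ord_lt_neq jk) ?(ord_lt_neq (ltn_trans ij jk)).
  by apply: (@descent_sets_sub_coclosed R n w v i j k) => //; rewrite ?vi ?vj ?vk; lia.
(* Now the values are w_k, w_i, w_j, turning 312 into 231. *)
pose v := (tperm i k * tperm i j * w)%g.
have vi : v i = w k.
  by rewrite !permM tpermL tpermD ?(ord_lt_neq jk) ?(ord_lt_neq (ltn_trans ij jk)).
have vj : v j = w i by rewrite !permM (tpermD (z := j)) ?tpermR ?(ord_lt_neq ij) ?(ord_lt_neq jk).
have vk : v k = w j by rewrite !permM tpermR tpermL.
by apply: (@descent_sets_sub_coclosed R n w v i j k) => //; rewrite ?vi ?vj ?vk; lia.
Qed.

Lemma avoids_descents_inversions (R : realType) n (w : 'S_n) (x : 'rV[R]_n) :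
  avoids w perm231 -> avoids w perm312 -> exists u, inversions u = descents w x.
Proof.
move=> av231 av312.
have between (i j k : 'I_n) : i < j -> j < k -> w k < w i -> (w k < w j) && (w j < w i).
  move=> ij jk ki; apply/andP; split; rewrite ltnNge; apply/negP => le_w.
    apply: av312; apply/contains312P; exists i, j, k; split=> //.
    by rewrite -(perm_lt_total w (ord_lt_neq jk).1) -leqNgt.
  apply: av231; apply/contains231P; exists i, j, k; split=> //.
  by rewrite -(perm_lt_total w (ord_lt_neq ij).1) -leqNgt.
apply: biclosed_inversions => [i j|i j k|i j k ij jk].
- by rewrite mem_descents mem_inversions; case/andP => /andP[].
- rewrite !mem_descents !mem_inversions => /andP[/andP[ij ij_w] ij_x] /andP[/andP[jk jk_w] jk_x].
  by rewrite (ltn_trans ij jk) (ltn_trans jk_w ij_w) (lt_trans jk_x ij_x).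
rewrite !mem_descents !mem_inversions ij jk => /andP[/andP[_ /(between _ _ _ ij jk)/andP[-> ->]]] /=.
(* Either x_j < x_i, or x_k < x_i <= x_j. *)
have [lt_x _|le_x lt_ki] := boolP (x ord0 j < x ord0 i)%R; first by left.
by right; apply: lt_le_trans lt_ki _; rewrite leNgt.
Qed.

Lemma avoids_descent_sets_sub (R : realType) n (w : 'S_n) :
  avoids w perm231 -> avoids w perm312 -> descent_sets R w \subset left_weak_inversions w.
Proof.
move=> av231 av312; apply/fintype.subsetP => S; rewrite inE => /asboolP[x _ <-].
have [u eq_u] := avoids_descents_inversions x av231 av312.
rewrite -eq_u; apply: imset_f; rewrite inE; apply/asboolP/left_weak_leE.
by rewrite eq_u; apply/fintype.subsetP => p; rewrite inE => /andP[].
Qed.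

Theorem theorem1p1 (R : realType) (n : nat) (hn : (1 <= n)%N) (w : 'S_n) :
  (wk w <= re R w)%N /\
  (re R w = wk w <-> avoids w perm231 /\ avoids w perm312).
Proof.
(* For nested finite sets, equal cardinals mean equal sets, so the equality case becomes the reverse
   inclusion. *)
have sub := left_weak_inversions_sub R w; have [le_card eq_card] := subset_leqif_cards sub.
rewrite re_descent_sets wk_left_weak_inversions; split=> //; split=> [eq_re|[av231 av312]].
  by apply: (@descent_sets_sub_avoids R); move: eq_card; rewrite eq_re eqxx => /esym/eqP->.
apply/esym/eqP; rewrite eq_card finset.eqEsubset sub; exact: avoids_descent_sets_sub.
Qed.
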